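(* Let $2^{\mathbb{N}}$ denote the Cantor set and let $\mathbb{F}$ be any countable free group. The set of topological $\mathbb{F}$-systems $\mathbb{F}\curvearrowright^a 2^{\mathbb{N}}$ with zero naive entropy, i.e. with $h^{\mathrm{tp}}_{\mathrm{nv}}(\mathbb{F}\curvearrowright^a 2^{\mathbb{N}})=0$, is comeager in $\mathrm{A}_{\mathrm{top}}(\mathbb{F},2^{\mathbb{N}})$.
   Context: For a countable discrete group $\Gamma$, a topological $\Gamma$-system $\Gamma \curvearrowright^a X$ consists of a compact metrizable space $X$ and a homomorphism $a:\Gamma\to \mathrm{Homeo}(X)$, where $\mathrm{Homeo}(X)$ is the group of homeomorphisms of $X$; write $\gamma^a$ for $a(\gamma)$. $\mathrm{A}_{\mathrm{top}}(\Gamma,X)$ is the Polish space of all topological $\Gamma$-systems with phase space $X$, where $a_n\to a$ if and only if for every $\gamma\in\Gamma$ the homeomorphisms $\gamma^{a_n}$ converge uniformly to $\gamma^a$. Naive topological entropy. For an open cover $\mathscr{U}$ of $X$, $N(\mathscr{U})$ is the minimal cardinality of a subcover. The join $\bigvee$ of finitely many open covers is the cover consisting of all intersections of one element from each. Put $\gamma^a\mathscr{U}=\{\gamma^a U: U\in\mathscr{U}\}$ and, for finite $F\subseteq\Gamma$, $\mathscr{U}^F=\bigvee_{\gamma\in F}\gamma^a\mathscr{U}$. Define $h^{\mathrm{tp}}_{\mathrm{nv}}(\mathscr{U})=\inf_F \frac{1}{|F|}\log N(\mathscr{U}^F)$, the infimum over all nonempty finite $F\subseteq\Gamma$, and $h^{\mathrm{tp}}_{\mathrm{nv}}(\Gamma\curvearrowright^a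 X)=\sup\{h^{\mathrm{tp}}_{\mathrm{nv}}(\mathscr{U}) : \mathscr{U}\text{ a finite open cover of }X\}$.
   Formalization: The free group is assumed nontrivial: for the trivial group (free of rank 0) the unique system on the Cantor set has infinite naive entropy, so the zero-entropy set is empty and not comeager. *)

(* Defs.v *)
From HB Require Import structures.
From mathcomp Require Import all_boot all_order all_algebra finmap.
From mathcomp Require Import all_classical all_reals all_analysis.
From mathcomp Require Import borel_hierarchy.

Set Implicit Arguments.
Unset Strict Implicit.
Unset Printing Implicit Defensive.

Local Open Scope classical_set_scope.
Local Open Scope ring_scope.

(** Free groups, by their universal property.  A map defined on [S] is given
    as a total function [f : G -> H] of which only the values on [S] matter. *)
Definition free_basis (G : groupType) (S : set G) : Prop :=
  forall (H : groupType) (f : G -> H),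
    (exists phi : {multiplicative G -> H}, forall s, S s -> phi s = f s) /\
    (forall phi psi : {multiplicative G -> H},
      (forall s, S s -> phi s = psi s) -> forall g, phi g = psi g).

Definition free_group (G : groupType) : Prop :=
  exists S : set G, free_basis S.

Record homeo (X : topologicalType) : Type := Homeo {
  homeo_fun :> X -> X;
  homeo_inv : X -> X;
  homeo_funK : cancel homeo_fun homeo_inv;
  homeo_invK : cancel homeo_inv homeo_fun;
  homeo_fun_continuous : continuous homeo_fun;
  homeo_inv_continuous : continuous homeo_inv
}.

Lemma homeo_eq (X : topologicalType) (f g : homeo X) :
  (f : X -> X) =1 g -> f = g.
Proof.
case: f g => [f f' fK f'K cf cf'] [g g' gK g'K cg cg'] /= fg.
have {}fg : f = g by apply/funext.
subst g; have e : f' = g'.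
  by apply/funext => x; rewrite -{1}(g'K x) fK.
by subst g'; congr Homeo; exact: Prop_irrelevance.
Qed.

Section HomeoGroup.
Variable X : topologicalType.
Implicit Types f g h : homeo X.

HB.instance Definition _ := gen_eqMixin (homeo X).
HB.instance Definition _ := gen_choiceMixin (homeo X).

Lemma id_continuous : continuous (id : X -> X).
Proof. by move=> x; exact: cvg_id. Qed.

Definition homeo_one : homeo X :=
  @Homeo X id id (fun=> erefl) (fun=> erefl) id_continuous id_continuous.

Definition homeo_inverse f : homeo X :=
  Homeo (@homeo_invK X f) (@homeo_funK X f) (@homeo_inv_continuous X f)
    (@homeo_fun_continuous X f).

Lemma homeo_comp_continuous f g : continuous (f \o g).
Proof.
by move=> x; apply: continuous_comp; exact: homeo_fun_continuous.
Qed.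

Lemma homeo_comp_inv_continuous f g : continuous (homeo_inv g \o homeo_inv f).
Proof.
by move=> x; apply: continuous_comp; exact: homeo_inv_continuous.
Qed.

Definition homeo_comp f g : homeo X :=
  Homeo (can_comp (@homeo_funK X f) (@homeo_funK X g))
    (can_comp (@homeo_invK X g) (@homeo_invK X f))
    (@homeo_comp_continuous f g) (@homeo_comp_inv_continuous f g).

Lemma homeo_compA : associative homeo_comp.
Proof. by move=> f g h; exact: homeo_eq. Qed.

Lemma homeo_comp1 : left_id homeo_one homeo_comp.
Proof. by move=> f; exact: homeo_eq. Qed.

Lemma homeo_1comp : right_id homeo_one homeo_comp.
Proof. by move=> f; exact: homeo_eq. Qed.

Lemma homeo_compV : left_inverse homeo_one homeo_inverse homeo_comp.
Proof. by move=> f; apply: homeo_eq => x /=; exact: homeo_funK. Qed.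

Lemma homeo_Vcomp : right_inverse homeo_one homeo_inverse homeo_comp.
Proof. by move=> f; apply: homeo_eq => x /=; exact: homeo_invK. Qed.

HB.instance Definition _ := isGroup.Build (homeo X)
  homeo_compA homeo_comp1 homeo_1comp homeo_compV homeo_Vcomp.

End HomeoGroup.

Definition top_system (G : groupType) (X : uniformType) : Type :=
  {multiplicative G -> homeo X}.

Definition top_act (G : groupType) (X : uniformType) (a : top_system G X) :
  G -> homeo X := Multiplicative.sort a.

Definition top_system_fun (G : groupType) (X : uniformType)
    (a : top_system G X) : prod_topology (fun _ : G => {uniform X -> X}) :=
  fun g => homeo_fun (top_act a g).

(** [a_n --> a] iff for every [g] the maps [top_act (a_n) g] converge uniformly
    to [top_act a g]: the initial topology for the embedding into the product,
    over [g : G], of the spaces [X -> X] with uniform convergence.  A compact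
    Hausdorff [X] has only one compatible uniformity, so that the uniform
    structure of [X] involves no choice. *)
HB.instance Definition _ (G : groupType) (X : uniformType) :=
  gen_eqMixin (top_system G X).
HB.instance Definition _ (G : groupType) (X : uniformType) :=
  gen_choiceMixin (top_system G X).
HB.instance Definition _ (G : groupType) (X : uniformType) :=
  Topological.copy (top_system G X)
    (initial_topology (@top_system_fun G X)).

Definition comeager (T : topologicalType) (A : set T) : Prop :=
  exists2 B : set T, Gdelta_dense B & B `<=` A.

Definition covers (X : Type) (U : set (set X)) : Prop :=
  \bigcup_(A in U) A = [set: X].

Definition open_cover (X : topologicalType) (U : set (set X)) : Prop :=
  (forall A, U A -> open A) /\ covers U.

Definition subcover_cards (X : Type) (U : set (set X)) : set nat :=
  [set k | exists V, [/\ V `<=` U, covers V & (V #= `I_k)%card]].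

(** Least element of [subcover_cards U].  It exists as soon as [U] has a finite
    subcover; otherwise the value is irrelevant. *)
Definition min_subcover (X : Type) (U : set (set X)) : nat :=
  get [set k | subcover_cards U k /\
               forall j, subcover_cards U j -> (k <= j)%N].

Definition join_covers (I : choiceType) (X : Type) (F : {fset I})
    (W : I -> set (set X)) : set (set X) :=
  [set \bigcap_(i in [set` F]) A i | A in
    [set A : I -> set X | forall i, i \in F -> W i (A i)]].

Definition translate_cover (X : Type) (f : X -> X) (U : set (set X)) :
  set (set X) := [set f @` A | A in U].

Section NaiveEntropy.
Variables (R : realType) (G : groupType) (X : uniformType).
Variable a : top_system G X.

Definition iterated_join (U : set (set X)) (F : {fset G}) : set (set X) :=
  join_covers F (fun g => translate_cover (top_act a g) U).

Definition naive_entropy_cover (U : set (set X)) : \bar R :=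
  ereal_inf [set (ln (min_subcover (iterated_join U F))%:R / #|` F|%:R)%:E
            | F in [set F : {fset G} | F != fset0]].

Definition naive_entropy : \bar R :=
  ereal_sup [set naive_entropy_cover U
            | U in [set U : set (set X) | finite_set U /\ open_cover U]].

End NaiveEntropy.

Arguments naive_entropy R {G X} a.

(* Main.v *)
Require Import Defs.
From HB Require Import structures.
From mathcomp Require Import all_boot all_order all_algebra finmap fingroup.
From mathcomp Require Import all_classical all_reals all_analysis.
From mathcomp Require Import borel_hierarchy.
From mathcomp Require Import lra.

(** It suffices that one element [s] of a free basis acts with zero entropy: the
    powers [s^-i], [i < n], are legitimate finite sets in the definition of naive
    entropy.  That the coding of length-[n] orbits of [s] by their first [m] bits
    uses few symbols is an open condition, so only density is at stake.

    Given a homeomorphism [f] of the Cantor set, choose in every [m]-cylinder [q]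
    two points [e q] and [c q] such that no [f (c q)] is an [e q'], and let [h]
    preserve every [m]-cylinder and map the complement in [q] of a small ball
    around [e q] onto a small ball around [c q].  Then [h \o f] is uniformly close
    to [f], the union [V] of the balls around the [c q] is forward invariant, the
    [m]-cylinder of a point of [V] determines that of its image, and the
    [m]-cylinder of a point outside [V] determines that of its preimage.  Hence
    an orbit segment of length [n] is coded by its entrance time into [V] and the
    two cylinders visited around that time, which leaves at most
    [(n + 1) * (2^m)^2] codes.  Freeness allows replacing [f] by [h \o f] on [s]
    while keeping the action of the other basis elements. *)

Set Implicit Arguments.
Unset Strict Implicit.
Unset Printing Implicit Defensive.

Import Order.TTheory GRing.Theory Num.Theory.

Local Open Scope classical_set_scope.

(** * Initial segments and uniform continuity on the Cantor set *)

Definition agree (m : nat) (x y : cantor_space) : Prop :=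
  forall i, (i < m)%N -> x i = y i.

Lemma agree_sym m x y : agree m x y -> agree m y x.
Proof. by move=> xy i im; rewrite xy. Qed.

Lemma agree_trans m y x z : agree m x y -> agree m y z -> agree m x z.
Proof. by move=> xy yz i im; rewrite xy ?yz. Qed.

Lemma agree_le m k x y : (m <= k)%N -> agree k x y -> agree m x y.
Proof. by move=> mk xy i im; apply: xy; exact: leq_trans mk. Qed.

Lemma neq_disagree (x y : cantor_space) : x <> y -> exists m, ~ agree m x y.
Proof.
move=> xy; apply: contrapT => /forallNP h; apply: xy; apply/funext => i.
by have /contrapT /(_ i (ltnSn i)) := h i.+1.
Qed.

(** Flip bit [m]. This makes a ball of depth [k] a proper subset of the [m]-cylinder around it. *)
Lemma agree_neighbor m k (z : cantor_space) : (m < k)%N ->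
  exists2 x, agree m z x & ~ agree k z x.
Proof.
move=> mk; exists (fun i => if i == m then ~~ z i else z i).
  by move=> i im; rewrite ltn_eqF.
by move=> /(_ m mk); rewrite eqxx => /esym; case: (z m).
Qed.

(** [agree m] are the basic entourages of the Cantor space, so [ucont] is uniform
    continuity. *)
Definition ucont (f : cantor_space -> cantor_space) : Prop :=
  forall m, exists k, forall x y, agree k x y -> agree m (f x) (f y).

Lemma ucont_comp f g : ucont f -> ucont g -> ucont (f \o g).
Proof.
move=> cf cg m; have [k fk] := cf m; have [l gl] := cg k.
by exists l => x y /gl /fk.
Qed.

Lemma ex_uniform_bound (I : finType) (P : I -> nat -> Prop) :
  (forall i m k, (m <= k)%N -> P i m -> P i k) ->
  (forall i, exists m, P i m) -> exists m, forall i, P i m.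
Proof.
move=> Pmono /choice[b Pb]; exists (\max_i b i) => i.
exact: Pmono (leq_bigmax i) (Pb i).
Qed.

(** * Gluing homeomorphisms along finite clopen partitions *)

Definition locally_constant (I : Type) (p : cantor_space -> I) : Prop :=
  exists m, forall x y, agree m x y -> p x = p y.

Lemma ucont_glue (I : finType) (p : cantor_space -> I)
    (f : I -> cantor_space -> cantor_space) :
  locally_constant p -> (forall i, ucont (f i)) -> ucont (fun x => f (p x) x).
Proof.
move=> [l pl] cf m.
have [|k fk] := @ex_uniform_bound I
    (fun i k => forall x y, agree k x y -> agree m (f i x) (f i y)) _
    (fun i => cf i m).
  by move=> i k k' kk' h x y /(agree_le kk') /h.
exists (maxn k l) => x y xy; rewrite (pl x y).
  by apply: fk; apply: agree_le xy; rewrite leq_maxl.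
by apply: agree_le xy; rewrite leq_maxr.
Qed.

(** The maps are total: only their restrictions to [A] and [B] are inverse to each
    other, which makes gluing over a clopen partition a mere case distinction. *)
Definition homeo_sets (A B : set cantor_space) : Prop :=
  exists f g, [/\ ucont f, ucont g,
    forall x, A x -> B (f x) /\ g (f x) = x &
    forall y, B y -> A (g y) /\ f (g y) = y].

Lemma homeo_sets_refl A : homeo_sets A A.
Proof. by exists id, id; split=> // m; exists m. Qed.

Lemma homeo_sets_sym A B : homeo_sets A B -> homeo_sets B A.
Proof. by move=> [f [g [cf cg fg gf]]]; exists g, f. Qed.

Lemma homeo_sets_trans B A D : homeo_sets A B -> homeo_sets B D -> homeo_sets A D.
Proof.
move=> [f [g [cf cg fg gf]]] [f' [g' [cf' cg' fg' gf']]].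
exists (f' \o f), (g \o g'); split; [exact: ucont_comp|exact: ucont_comp|..].
- by move=> x /fg[/fg'[? /= ->]].
- by move=> y /gf'[/gf[? /= ->]].
Qed.

(** The clause [q (f x) = p x] records which piece goes to which; with cylinders among the labels it
    keeps the glued map close to the identity. *)
Lemma homeo_sets_glue (I : finType) (p q : cantor_space -> I)
    (A B : set cantor_space) :
  locally_constant p -> locally_constant q ->
  (forall i, homeo_sets (A `&` p @^-1` [set i]) (B `&` q @^-1` [set i])) ->
  exists f g, [/\ ucont f, ucont g,
    forall x, A x -> [/\ B (f x), g (f x) = x & q (f x) = p x] &
    forall y, B y -> A (g y) /\ f (g y) = y].
Proof.
move=> cp cq /choice[f /choice[g fg]].
exists (fun x => f (p x) x), (fun y => g (q y) y).
split; [by apply: ucont_glue => // i; case: (fg i)..| |].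
- move=> x Ax; have [_ _ /(_ x)[//|[Bfx qfx] gfx] _] := fg (p x).
  by split=> //; rewrite qfx.
- move=> y By; have [_ _ _ /(_ y)[//|[Agy pgy] fgy]] := fg (q y).
  by split=> //; rewrite pgy.
Qed.

Definition scons (b : bool) (x : cantor_space) : cantor_space :=
  fun i => if i is j.+1 then x j else b.

Definition stail (x : cantor_space) : cantor_space := fun i => x i.+1.

Lemma sconsK (x : cantor_space) : scons (x 0%N) (stail x) = x.
Proof. by apply/funext; case. Qed.

Lemma agree_scons m b x y : agree m x y -> agree m.+1 (scons b x) (scons b y).
Proof. by move=> xy [|i] //= im; exact: xy. Qed.

Lemma homeo_sets_scons b (A : set cantor_space) :
  homeo_sets (A `&` [set x | x 0%N = b]) (scons b @^-1` A).
Proof.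
exists stail, (scons b); split.
- by move=> m; exists m.+1 => x y xy i im; exact: xy.
- by move=> m; exists m => x y xy; apply: agree_le (agree_scons b xy).
- by move=> x [Ax <-] /=; rewrite sconsK.
- by move=> y.
Qed.

Definition determined m (A : set cantor_space) : Prop :=
  forall x y, agree m x y -> A x -> A y.

(** Split [A] by the first bit. If both halves are nonempty, the induction hypothesis matches each
    with the corresponding half of the Cantor set; if one is empty, deleting the constant first bit
    lowers [m]. *)
Lemma homeo_sets_setT m (A : set cantor_space) :
  determined m A -> A !=set0 -> homeo_sets A setT.
Proof.
elim: m A => [A dA [x Ax]|m IH A dA [x Ax]].
  rewrite (_ : A = setT); first exact: homeo_sets_refl.
  by apply/seteqP; split=> // y _; exact: dA Ax.
have dAb b : determined m (scons b @^-1` A).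
  by move=> y z yz; apply: dA; exact: agree_scons.
have Ax0 : (scons (x 0%N) @^-1` A) (stail x) by rewrite /= sconsK.
have [[y Ay]|A0] := pselect (scons (~~ x 0%N) @^-1` A !=set0).
  have [||b|f [g [cf cg fg gf]]] :=
      @homeo_sets_glue bool (fun x => x 0%N) (fun x => x 0%N) A setT.
  - by exists 1%N => u v; apply.
  - by exists 1%N => u v; apply.
  - apply: homeo_sets_trans (homeo_sets_scons b A) _.
    apply: homeo_sets_trans (homeo_sets_sym (homeo_sets_scons b setT)).
    apply: IH => //; have [->|] := eqVneq b (x 0%N); first by exists (stail x).
    by move=> bx; exists y; rewrite (_ : b = ~~ x 0%N) //; case: b (x 0%N) bx => [] [].
  - by exists f, g; split=> // z /fg[].
have -> : A = A `&` [set z | z 0%N = x 0%N].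
  apply/seteqP; split=> [z Az|z []//]; split=> //=; apply: contrapT => /eqP z0.
  apply: A0; exists (stail z); rewrite /= (_ : ~~ x 0%N = z 0%N) ?sconsK //.
  by case: (x 0%N) (z 0%N) z0 => [] [].
apply: homeo_sets_trans (homeo_sets_scons _ A) _; apply: IH => //.
by exists (stail x).
Qed.

(** * Cylinders and small balls inside them *)

Definition first_bits m (x : cantor_space) : {ffun 'I_m -> bool} :=
  [ffun i : 'I_m => x i].

Lemma first_bitsP m x y : first_bits m x = first_bits m y <-> agree m x y.
Proof.
split=> [xy i im|xy]; last by apply/ffunP => i; rewrite !ffunE xy.
by move/ffunP: xy => /(_ (Ordinal im)); rewrite !ffunE.
Qed.

(** Varying the tail [t] yields infinitely many points in the cylinder [q], which leaves room for
    choosing centres. *)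
Definition point_of m (t : nat -> bool) (q : {ffun 'I_m -> bool}) :
  cantor_space := fun i => if insub i is Some j then q j else t (i - m)%N.

Lemma first_bits_point_of m t q : first_bits m (point_of t q) = q.
Proof.
by apply/ffunP => i; rewrite ffunE /point_of valK.
Qed.

Lemma point_of_tail m t q i : @point_of m t q (m + i)%N = t i.
Proof.
by rewrite /point_of insubF ?addKn // ltnNge leq_addr.
Qed.

Lemma locally_constant_first_bits m : locally_constant (first_bits m).
Proof. by exists m => x y /first_bitsP. Qed.

Lemma locally_constant_pair (I J : Type) (p : cantor_space -> I)
    (q : cantor_space -> J) : locally_constant p -> locally_constant q ->
  locally_constant (fun x => (p x, q x)).
Proof.
move=> [k pk] [l ql]; exists (maxn k l) => x y xy; congr pair.
  by apply: pk; apply: agree_le xy; rewrite leq_maxl.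
by apply: ql; apply: agree_le xy; rewrite leq_maxr.
Qed.

Lemma determined_locally_constant m (A : set cantor_space) :
  determined m A -> locally_constant (fun x => `[< A x >]).
Proof.
move=> dA; exists m => x y xy; apply/asboolP/asboolP; apply: dA => //.
exact: agree_sym.
Qed.

Lemma determinedI m (A B : set cantor_space) :
  determined m A -> determined m B -> determined m (A `&` B).
Proof. by move=> dA dB x y xy [Ax Bx]; split; [apply: dA Ax|apply: dB Bx]. Qed.

Lemma determinedC m (A : set cantor_space) : determined m A -> determined m (~` A).
Proof. by move=> dA x y xy nAx Ay; apply: nAx; apply: dA Ay; exact: agree_sym. Qed.

Lemma determined_le m k (A : set cantor_space) : (m <= k)%N ->
  determined m A -> determined k A.
Proof. by move=> mk dA x y /(agree_le mk); exact: dA. Qed.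

Lemma determined_first_bits m q : determined m (first_bits m @^-1` [set q]).
Proof. by move=> x y /first_bitsP /= ->. Qed.

Definition balls m k (c : {ffun 'I_m -> bool} -> cantor_space) : set cantor_space :=
  [set x | agree k (c (first_bits m x)) x].

Lemma determined_balls m k c : (m <= k)%N -> determined k (balls k (m := m) c).
Proof.
move=> mk x y xy; rewrite /balls /= => cx.
have /first_bitsP <- := agree_le mk xy.
exact: agree_trans xy.
Qed.

Lemma balls_in m k c q : first_bits m (c q) = q ->
  (balls k c `&` first_bits m @^-1` [set q]) !=set0.
Proof. by move=> cq; exists (c q); split=> //; rewrite /balls /= cq. Qed.

Lemma balls_out m k c q : (m < k)%N -> first_bits m (c q) = q ->
  (~` balls k c `&` first_bits m @^-1` [set q]) !=set0.
Proof.
move=> mk cq; have [x cx ncx] := agree_neighbor (c q) mk.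
have qx : first_bits m x = q by rewrite -cq; apply/first_bitsP; exact: agree_sym.
by exists x; split=> //; rewrite /balls /= qx.
Qed.

(** * The perturbation that creates an attractor *)

Lemma determined_homeo_sets m (A B : set cantor_space) : determined m A ->
  determined m B -> A !=set0 -> B !=set0 -> homeo_sets A B.
Proof.
move=> dA dB A0 B0; apply: (@homeo_sets_trans setT); first exact: homeo_sets_setT dA A0.
exact/homeo_sets_sym/homeo_sets_setT/B0/dB.
Qed.

(** In every [m]-cylinder, the ball around [e q], the ball around [c q] and their complements are
    nonempty clopen sets, hence pairwise homeomorphic. Gluing sends the [e]-ball onto the complement
    of the [c]-ball and the rest onto the [c]-ball. *)
Lemma exists_contraction m k (e c : {ffun 'I_m -> bool} -> cantor_space) :
  (m < k)%N -> cancel e (first_bits m) -> cancel c (first_bits m) ->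
  exists h h', [/\ ucont h, ucont h', cancel h h', cancel h' h &
    forall x, agree m (h x) x /\ (balls k c (h x) <-> ~ balls k e x)].
Proof.
move=> mk eK cK.
have dE := @determined_balls m k e (ltnW mk).
have dV := @determined_balls m k c (ltnW mk).
pose E := balls k e; pose V := balls k c.
have [||[q b]|h [h' [ch ch' hP h'P]]] := @homeo_sets_glue
    ({ffun 'I_m -> bool} * bool)%type
    (fun x => (first_bits m x, `[< E x >]))
    (fun x => (first_bits m x, `[< (~` V) x >]))
    setT setT.
- apply: locally_constant_pair (@locally_constant_first_bits m) _.
  exact: determined_locally_constant dE.
- apply: locally_constant_pair (@locally_constant_first_bits m) _.
  exact: determined_locally_constant (determinedC dV).
- have eqI (A : set cantor_space) :
    setT `&` (fun x => (first_bits m x, `[< A x >])) @^-1` [set (q, b)] = (if b then A else ~` A) `&` first_bits m @^-1` [set q].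
    rewrite setTI; apply/seteqP; split=> x /=.
      by move=> [-> <-]; split=> //; case: asboolP.
    by case: b => -[Ax ->]; congr pair; [exact/asboolP|apply/asboolPn].
  rewrite !eqI setCK.
  have dq := determined_le (ltnW mk) (@determined_first_bits m q).
  by case: b {eqI}; apply: (@determined_homeo_sets k);
    try (apply: determinedI => //; try exact: determinedC);
    solve [exact: balls_in|exact: balls_out].
- exists h, h'; split=> // [x|x|x]; [by have [] := hP x I|by have [] := h'P x I|].
  have [_ _ [/first_bitsP hx Ehx]] := hP x I; split=> //.
  rewrite -/V -/E; split=> [Vhx Ex|nEx].
    by move/asboolP: Ex; rewrite -Ehx => /asboolP.
  by apply: contrapT => /asboolP; rewrite Ehx => /asboolP.
Qed.

(** Pigeonhole: [#|I| + 1] distinct values cannot all lie in the range of [e]. *)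
Lemma exists_avoiding (f : cantor_space -> cantor_space) (I : finType)
    (c : nat -> cantor_space) (e : I -> cantor_space) :
  injective f -> injective c -> exists k, forall i, f (c k) <> e i.
Proof.
move=> fI cI; apply: contrapT => /forallNP bad.
have {}bad k : exists i, f (c k) = e i.
  by have /existsNP[i /contrapT] := bad k; exists i.
have [j jP] := choice bad.
have jI : injective (fun k : 'I_#|I|.+1 => j k).
  move=> k l jkl; apply/val_inj/cI/fI; by rewrite !jP jkl.
by have := leq_card _ jI; rewrite card_ord ltnn.
Qed.

Lemma exists_attractor (f f' : cantor_space -> cantor_space) m :
  ucont f -> ucont f' -> cancel f f' -> cancel f' f ->
  exists h h' (V : set cantor_space), [/\ ucont h, ucont h', cancel h h',
    cancel h' h & [/\ forall x, agree m (h x) x,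
    forall x, V x -> V (h (f x)),
    forall x y, V x -> V y -> agree m x y -> agree m (h (f x)) (h (f y)) &
    forall x y, ~ V (h (f x)) -> ~ V (h (f y)) ->
      agree m (h (f x)) (h (f y)) -> agree m x y]].
Proof.
move=> cf cf' fK f'K; pose K := ({ffun 'I_m -> bool})%type.
pose e := @point_of m (fun=> false).
have ex_c (q : K) : exists c, first_bits m c = q /\ forall q', f c <> e q'.
  have [||k fk] := @exists_avoiding f _ (fun k => point_of (fun i => i == k) q) e.
  - exact: can_inj fK.
  - move=> k l /(congr1 (fun x : cantor_space => x (m + k)%N)).
    by rewrite !point_of_tail eqxx => /esym/eqP.
  - by exists (point_of (fun i => i == k) q); rewrite first_bits_point_of.
have [c cP] := choice ex_c.
have [||l0 sep] := @ex_uniform_bound (K * K)%type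
    (fun q l => ~ agree l (e q.2) (f (c q.1))).
- by move=> q k l kl + /(agree_le kl).
- by case=> q q'; apply: neq_disagree; have [_ /(_ q')/nesym] := cP q.
have [l1 fl1] := cf (maxn l0 m); have [l2 fl2] := cf' m.
(* Depth [k] exceeds [m], so balls are proper in their cylinders. At depth [l0] every [f (c q)] is
   separated from every [e q']; [l1] controls [f] on a ball up to depth [maxn l0 m], and [l2]
   controls [f'] up to depth [m]. *)
pose k := maxn (maxn m.+1 l0) (maxn l1 l2).
have mk : (m < k)%N by rewrite /k !leq_max leqnn.
have l0k : (l0 <= k)%N by rewrite /k !leq_max leqnn orbT.
have l1k : (l1 <= k)%N by rewrite /k !leq_max leqnn !orbT.
have l2k : (l2 <= k)%N by rewrite /k !leq_max leqnn !orbT.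
have [|q|h [h' [ch ch' hK h'K hP]]] := @exists_contraction m k e c mk.
- exact: first_bits_point_of.
- by have [] := cP q.
exists h, h', (balls k c); split=> //; split.
- by move=> x; have [] := hP x.
(* Otherwise [f x] would agree to depth [l0] both with some [e q'] and with some [f (c q)], against
   [sep]. *)
- move=> x Vx; apply/(hP (f x)).2 => Efx.
  have fcx : agree l0 (f (c (first_bits m x))) (f x).
    by apply: (@agree_le _ (maxn l0 m)); rewrite ?leq_maxl //; apply: fl1;
       exact: agree_le Vx.
  apply: (sep (first_bits m x, first_bits m (f x))) => /=.
  by apply: agree_trans (agree_sym fcx); exact: agree_le Efx.
- move=> x y Vx Vy /first_bitsP xy; apply: agree_trans (hP (f x)).1 _.
  apply: agree_trans (agree_sym (hP (f y)).1).
  apply: (@agree_le _ (maxn l0 m)); rewrite ?leq_maxr //; apply: fl1.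
  apply: (agree_le l1k); apply: agree_trans (agree_sym Vx) _.
  by rewrite xy.
(* Images outside [V] come from the balls around the [e q]. Since [h] preserves cylinders, [f x] and
   [f y] lie in the same ball, and [f'] carries this back to agreement of [x] and [y]. *)
- move=> x y nVx nVy xy.
  have /contrapT Ex : ~ ~ balls k e (f x) by move=> /(hP (f x)).2.
  have /contrapT Ey : ~ ~ balls k e (f y) by move=> /(hP (f y)).2.
  rewrite -(fK x) -(fK y); apply: fl2; apply: (agree_le l2k).
  apply: agree_trans (agree_sym Ex) _.
  rewrite (_ : first_bits m (f x) = first_bits m (f y)) //.
  apply/first_bitsP; apply: agree_trans (agree_sym (hP (f x)).1) _.
  exact: agree_trans (hP (f y)).1.
Qed.

(** * Coding orbit segments *)

Definition coded n m (g : cantor_space -> cantor_space) (T : finType) : Prop :=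
  exists c : cantor_space -> T, forall x y, c x = c y ->
    forall i, (i < n)%N -> agree m (iter i g x) (iter i g y).

Lemma coded_le n m k g T : (m <= k)%N -> coded n k g T -> coded n m g T.
Proof.
by move=> mk [c cP]; exists c => x y /cP h i /h; exact: agree_le.
Qed.

Lemma coded_eq n m g g' T : g =1 g' -> coded n m g T -> coded n m g' T.
Proof. by move=> /funext ->. Qed.

Lemma coded_attractor m (g : cantor_space -> cantor_space)
    (V : set cantor_space) n :
  (forall x, V x -> V (g x)) ->
  (forall x y, V x -> V y -> agree m x y -> agree m (g x) (g y)) ->
  (forall x y, ~ V (g x) -> ~ V (g y) -> agree m (g x) (g y) -> agree m x y) ->
  coded n m g ('I_n.+1 * ({ffun 'I_m -> bool} * {ffun 'I_m -> bool}))%type.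
Proof.
move=> gV fwd bwd.
pose inV x i := `[< V (iter i g x) >].
(* An orbit that misses [V] at all times below [n] gets the value [n], whence [n + 1] possible
   entrance times. *)
pose t x := find (inV x) (iota 0 n).
have tn x : (t x < n.+1)%N by rewrite ltnS -[X in (_ <= X)%N](size_iota 0) find_size.
have Vt x i : (t x <= i < n)%N -> V (iter i g x).
  move=> /andP[ti iN]; have tltn : (t x < n)%N := leq_ltn_trans ti iN.
  have Vtx : V (iter (t x) g x).
    have /(nth_find 0%N) : has (inV x) (iota 0 n) by rewrite has_find size_iota.
    by rewrite nth_iota // add0n => /asboolP.
  by rewrite -(subnK ti); elim: (i - t x)%N => //= j /gV.
have nVt x i : (i < t x)%N -> ~ V (iter i g x).
  move=> it; have /(before_find 0%N) := it.
  rewrite nth_iota; last by rewrite -ltnS; exact: leq_trans (tn x).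
  by rewrite add0n => /asboolP.
(* When the entrance time is 0, [.-1] truncates harmlessly: only the forward case below arises, and
   it starts from the first cylinder. *)
exists (fun x => (Ordinal (tn x),
  (first_bits m (iter (t x) g x), first_bits m (iter (t x).-1 g x)))) => x y.
move=> [] txy; rewrite -txy => /first_bitsP et /first_bitsP ep i iN.
have [ti|it] := leqP (t x) i.
  elim: i ti iN => [|i IH]; first by rewrite leqn0 => /eqP t0; move: et; rewrite t0.
  rewrite leq_eqVlt => /predU1P[<- _ //|ti iN]; apply: fwd.
  - by apply: Vt; rewrite -ltnS ti ltnW.
  - by apply: Vt; rewrite -txy -ltnS ti ltnW.
  - by apply: IH => //; exact: ltnW.
have : (i <= (t x).-1)%N by rewrite -ltnS (ltn_predK it).
have tp : ((t x).-1 < t x)%N by rewrite (ltn_predK it).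
(* Before the entrance time, descend from [(t x).-1] by [bwd]; [d] is the number of steps still to
   go back. *)
move=> {it iN} /subnK; move: ((t x).-1 - i)%N => d.
elim: d i => [|d IH] i di; first by rewrite -di in ep.
apply: bwd.
- by apply: (nVt x i.+1); apply: leq_ltn_trans tp; rewrite -di addSnnS leq_addl.
- by apply: (nVt y i.+1); rewrite -txy; apply: leq_ltn_trans tp; rewrite -di addSnnS leq_addl.
- by apply: (IH i.+1); rewrite -addSnnS.
Qed.

(** * Uniform structure and compactness of the Cantor set *)

Lemma entourage_agree m :
  entourage [set xy : cantor_space * cantor_space | agree m xy.1 xy.2].
Proof.
elim: m => [|m IH].
  by apply: filterS (@entourageT cantor_space) => xy _ i.
have Em : entourage [set xy : cantor_space * cantor_space | xy.1 m = xy.2 m].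
  pose W := [set xy : cantor_space * cantor_space | xy.1 m = xy.2 m].
  have entW : `[< @entourage (initial_topology (@proj nat (fun=> bool) m)) W >].
    apply/asboolP; exists [set bb | bb.1 = bb.2] => //.
    by rewrite uniform_discrete => _ [b _ <-].
  exists W => //.
  exact: (@finI_from1 _ _ _ _ (exist _ ((m : {classic nat}), W) entW)).
apply: filterS (filterI IH Em) => -[x y] /= [xy xym] i.
by rewrite ltnS leq_eqVlt => /predU1P[->//|]; exact: xy.
Qed.

Lemma entourage_cantorP (E : set (cantor_space * cantor_space)) :
  entourage E -> exists m, forall x y, agree m x y -> E (x, y).
Proof.
move=> [_ [D _ <-] DE].
(* A basic entourage constrains finitely many coordinates; this depth lies beyond all of them. *)
exists (\max_(i : D) (projT1 (val i)).1.+1) => x y xy; apply: DE => i iD.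
have [V entV] := (asboolP _ (projT2 i)).
apply; have Vdiag (b b' : bool) : b = b' -> V (b, b').
  by move=> ->; exact: entourage_refl.
by apply: Vdiag; apply: xy; apply: (leq_bigmax (FSetSub iD)).
Qed.

Lemma nbhs_cantorP (x : cantor_space) (A : set cantor_space) :
  nbhs x A <-> exists m, agree m x `<=` A.
Proof.
split=> [|[m mA]].
  rewrite -nbhs_entourageE => -[E /entourage_cantorP[m mE] EA].
  by exists m => y /mE xy; apply: EA; apply/xsectionP.
apply: filterS mA _; rewrite -nbhs_entourageE; exists [set xy | agree m xy.1 xy.2].
  exact: entourage_agree.
by move=> y /xsectionP.
Qed.

Lemma open_agree m (x : cantor_space) : open (agree m x).
Proof.
rewrite openE => y xy; apply/nbhs_cantorP; exists m => z; exact: agree_trans.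
Qed.

(** Lebesgue's covering argument for a hereditary property: finitely many good cylinders cover, and
    their largest depth works everywhere. It serves both for uniform continuity and for Lebesgue
    numbers. *)
Lemma cantor_uniformly_small (P : set cantor_space -> Prop) :
  (forall A B, A `<=` B -> P B -> P A) ->
  (forall x, exists m, P (agree m x)) -> exists m, forall x, P (agree m x).
Proof.
move=> Pdown /choice[b Pb].
have := cantor_space_compact; rewrite compact_cover.
case/(_ cantor_space setT (fun x => agree (b x) x)).
- by move=> x _; exact: open_agree.
- by move=> x _; exists x.
move=> D _ DT; exists (\max_(x : D) b (val x)) => x.
have [y yD yx] := DT x I; apply: Pdown (Pb y) => z xz.
by apply: agree_trans yx _; apply: agree_le xz; exact: (leq_bigmax (FSetSub yD)).
Qed.

Lemma continuous_ucont (f : cantor_space -> cantor_space) :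
  continuous f <-> ucont f.
Proof.
split=> [cf m|cf x A /nbhs_cantorP[m mA]]; last first.
  have [k fk] := cf m; apply/nbhs_cantorP; exists k => y xy; exact/mA/fk.
have [A B AB PB x y Ax Ay|x|k kP] := @cantor_uniformly_small
    (fun A => forall x y, A x -> A y -> agree m (f x) (f y)).
- by apply: PB; exact: AB.
- have /nbhs_cantorP[k kf] : nbhs x (f @^-1` agree m (f x)).
    by apply: cf; apply/nbhs_cantorP; exists m.
  exists k => y z xy xz; apply: agree_trans (agree_sym _) (kf z xz); exact: kf.
- by exists k => x y xy; apply: (kP x).
Qed.

Lemma lebesgue_number (U : set (set cantor_space)) : open_cover U ->
  exists m, forall x, exists2 A, U A & agree m x `<=` A.
Proof.
move=> [oU cU]; apply: (@cantor_uniformly_small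
  (fun B => exists2 A, U A & B `<=` A)).
  by move=> A B AB [D UD BD]; exists D => //; exact: subset_trans BD.
move=> x; have [A UA Ax] : (\bigcup_(A in U) A) x by rewrite cU.
have /nbhs_cantorP[m mA] : nbhs x A by apply: open_nbhs_nbhs; split=> //; exact: oU.
by exists m, A.
Qed.

(** * Neighbourhoods in the space of systems *)

Section SystemTopology.
Variable G : groupType.
Implicit Types a b : top_system G cantor_space.

Definition close_at m a b (g : G) : Prop :=
  forall x, agree m (top_act a g x) (top_act b g x).

Lemma nbhs_close m a g : nbhs a [set b | close_at m a b g].
Proof.
have c1 : {for a, continuous (@top_system_fun G cantor_space)}.
  exact: (@initial_continuous (top_system G cantor_space) _
    (@top_system_fun G cantor_space)).
have c2 := @proj_continuous G (fun=> {uniform cantor_space -> cantor_space}) g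
  (top_system_fun a).
have c3 : nbhs (top_system_fun a g)
    [set f : {uniform cantor_space -> cantor_space} |
    forall x, agree m (top_act a g x) (f x)].
  apply/uniform_nbhs; exists [set xy | agree m xy.1 xy.2]; split.
    exact: entourage_agree.
  by move=> f /= af x; exact: af.
exact: c1 (c2 _ c3).
Qed.

Lemma nbhs_systemP a (W : set (top_system G cantor_space)) : nbhs a W ->
  exists (D : seq G) m,
    forall b, (forall g, g \in D -> close_at m a b g) -> W b.
Proof.
move=> [_ [[B oB <-] Ba BW]].
have : nbhs (top_system_fun a) B by apply: open_nbhs_nbhs.
rewrite -nbhs_entourageE => -[E [_ [D _ <-] DE] EB].
have DP (i : D) : exists m, forall b, close_at m a b (projT1 (val i)).1 ->
    (projT1 (val i)).2 (top_system_fun a, top_system_fun b).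
  have [V + VP] := asboolP _ (projT2 (val i)).
  rewrite uniform_entourage => -[Z /entourage_cantorP[m mZ] ZV].
  exists m => b ab; apply: VP; apply: ZV => x _; apply: mZ; exact: ab.
have [|m mP] := @ex_uniform_bound D (fun i m => forall b,
    close_at m a b (projT1 (val i)).1 ->
    (projT1 (val i)).2 (top_system_fun a, top_system_fun b)) _ DP.
  by move=> i k l kl + b ab; apply => x; apply: agree_le (ab x).
exists [seq (projT1 (val i)).1 | i : D], m => b ab.
apply: BW; apply: EB; apply/xsectionP; apply: DE => i iD.
apply: (mP (FSetSub iD)); apply: ab.
by apply: (map_f (fun i : D => (projT1 (val i)).1 : G)); rewrite mem_enum.
Qed.

End SystemTopology.

(** * Generation by a free basis and infinite order of its elements *)

Section Multiplicative.
Variables (G H : groupType) (f : {multiplicative G -> H}).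
Local Open Scope group_scope.

Lemma multiplicative1 : f 1 = 1.
Proof. by apply: (mulgI (f 1)); rewrite -gmulfM !mulg1. Qed.

Lemma multiplicativeX n : {morph f : x / x ^+ n}.
Proof.
by move=> x; elim: n => [|n IH]; [exact: multiplicative1|rewrite !expgS gmulfM IH].
Qed.

End Multiplicative.

Section FreeBasis.
Variables (G : groupType) (S : set G).
Hypothesis S_basis : free_basis S.
Local Open Scope group_scope.

Section Retraction.
Variable P : pred G.
Hypothesis P_group : group_closed P.

Let H : Type := {x : G | P x}.
HB.instance Definition _ := SubChoice.on H.
HB.instance Definition _ := SubChoice_isSubGroup.Build G P H P_group.

(** The universal property gives a retraction of [G] onto the subgroup [P]; by
    uniqueness its composite with the inclusion is the identity. *)
Lemma basis_retraction : (forall s, S s -> P s) -> forall g, P g.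
Proof.
move=> SP g.
have [[phi phiS] _] := S_basis (fun g : G => insubd (1 : H) g).
have [_ uniq] := S_basis (fun g : G => g).
rewrite -[g]/((idfun : {multiplicative G -> G}) g).
rewrite -(uniq ((val : {multiplicative H -> G}) \o phi) idfun) ?valP //.
by move=> s Ss /=; rewrite phiS // insubdK //; exact: SP.
Qed.
End Retraction.

Lemma basis_ind (P : G -> Prop) :
  (forall s, S s -> P s) -> P 1 -> (forall x y, P x -> P y -> P (x * y)) ->
  (forall x, P x -> P x^-1) -> forall g, P g.
Proof.
move=> PS P1 PM PV g; apply/asboolP.
apply: (@basis_retraction (fun x => `[< P x >])); last by move=> s /PS/asboolP.
split; first exact/asboolP.
by move=> x y /asboolP Px /asboolP Py; apply/asboolP; apply: PM => //; exact: PV.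
Qed.

Lemma basis_nonempty : (exists g : G, g <> 1) -> S !=set0.
Proof.
move=> [g g1]; apply: contrapT => S0; apply: g1; move: g; apply: basis_ind => //.
- by move=> s Ss; case: S0; exists s.
- by move=> x y -> ->; rewrite mulg1.
- by move=> x ->; rewrite invg1.
Qed.

(** Map every basis element to 1 in the cyclic group of order [N + 2], which exceeds both exponents;
    powers then have distinct images. *)
Lemma basis_expg_inj s : S s -> injective (fun n => s ^+ n).
Proof.
move=> Ss i j ij; pose N := maxn i j.
have [[phi phiS] _] := S_basis (fun _ : G => (inord 1 : 'I_N.+2)).
have phiX n : phi (s ^+ n) = inZp n.
  by rewrite multiplicativeX phiS // Zp_expg inordK // mul1n.
have := congr1 phi ij; rewrite !phiX => /(congr1 val) /=.
by rewrite !modn_small // ltnS leqW // ?leq_maxr ?leq_maxl.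
Qed.

End FreeBasis.

(** * Perturbing the action of one generator *)

Section Perturbation.
Variables (G : groupType) (S : set G).
Hypothesis S_basis : free_basis S.
Implicit Types a b : top_system G cantor_space.
Local Open Scope group_scope.

Lemma top_actM a g g' x : top_act a (g * g') x = top_act a g (top_act a g' x).
Proof. by rewrite /top_act gmulfM. Qed.

Lemma top_act1 a x : top_act a 1 x = x.
Proof. by rewrite /top_act multiplicative1. Qed.

Lemma top_actVK a g : cancel (top_act a g^-1) (top_act a g).
Proof. by move=> x; rewrite -top_actM mulgV top_act1. Qed.

Lemma top_actKV a g : cancel (top_act a g) (top_act a g^-1).
Proof. by move=> x; rewrite -top_actM mulVg top_act1. Qed.

Lemma top_actX a g n x : top_act a (g ^+ n) x = iter n (top_act a g) x.
Proof. by elim: n => [|n IH]; rewrite ?top_act1 // expgS top_actM IH. Qed.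

Lemma top_act_ucont a g : ucont (top_act a g).
Proof. exact/continuous_ucont/homeo_fun_continuous. Qed.

(** Only the moduli of continuity of [a] enter, so [k] does not depend on [b]. For an inverse, put
    [x = b y] and apply the modulus of the inverse under [a] to [a y] and [b y]. *)
Lemma ex_close_generators a g m : exists k, forall b,
  (forall s, S s -> close_at k a b s) -> close_at m a b g.
Proof.
move: g m; apply: (basis_ind S_basis) => [s Ss m|m|g g' IHg IHg' m|g IH m].
- by exists m => b; apply.
- by exists 0%N => b _ x; rewrite !top_act1.
- have [l al] := top_act_ucont a g m.
  have [k kP] := IHg m; have [k' k'P] := IHg' l.
  exists (maxn k k') => b ab x; rewrite !top_actM.
  apply: agree_trans (al _ _ _) (kP b _ _).
  + by apply: k'P => s Ss y; apply: agree_le (ab s Ss y); rewrite leq_maxr.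
  + by move=> s Ss y; apply: agree_le (ab s Ss y); rewrite leq_maxl.
- have [l al] := top_act_ucont a g^-1 m; have [k kP] := IH l.
  exists k => b ab x; rewrite -[x in top_act a _ x](top_actVK b g).
  by rewrite -[X in agree m _ X](top_actKV a g); apply: al; apply/agree_sym/kP.
Qed.

Lemma ex_perturbation a s (h : homeo cantor_space) : S s ->
  exists b : top_system G cantor_space,
    (forall x, top_act b s x = h (top_act a s x)) /\
    (forall t, S t -> t <> s -> forall x, top_act b t x = top_act a t x).
Proof.
move=> Ss; have [[b bS] _] := S_basis
  (fun t => if t == s then h * top_act a t else top_act a t).
exists b; rewrite /top_act; split=> [x|t St /eqP/negbTE ts x].
  by rewrite bS // eqxx.
by rewrite bS // ts.
Qed.

End Perturbation.

(** * Systems with few orbit names form an open dense set *)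

Local Open Scope ring_scope.

(** With [n > 4K / eps^2], [(n + 1) K <= 2nK < (eps n)^2 / 2], which is below [exp (eps n)] by its
    quadratic lower bound. *)
Lemma ln_lt_linear (R : realType) (K eps : R) : 0 < K -> 0 < eps ->
  exists2 n, (0 < n)%N & ln (n.+1%:R * K) / n%:R < eps.
Proof.
move=> K0 eps0; pose n := (Num.trunc (4 * K / eps ^+ 2)).+1.
have n0 : 0 < n%:R :> R by rewrite ltr0n.
exists n => //; rewrite ltr_pdivrMr // -[ltRHS]expRK ltr_ln ?posrE ?expR_gt0 //; last first.
  by rewrite mulr_gt0 // ltr0n.
have := truncnS_gt (4 * K / eps ^+ 2); rewrite -/n ltr_pdivrMr ?exprn_gt0 // => nK.
have := @expR_ge1Dxn _ (eps * n%:R) 1 (mulr_ge0 (ltW eps0) (ltW n0)).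
apply: lt_le_trans; rewrite (_ : 2`! = 2%N) //.
have n2 : n.+1%:R <= 2 * n%:R :> R.
  by rewrite -natrM ler_nat mul2n -addnn -addn1 leq_add2l.
have := ler_wpM2r (ltW K0) n2; move: nK; rewrite -(ltr_pM2l n0).
lra.
Qed.

Section FewNames.
Variables (R : realType) (G : groupType) (S : set G) (s : G).
Hypothesis S_basis : free_basis S.
Hypothesis Ss : S s.

(** A single length [n] is asked for, since naive entropy is an infimum; this also makes the
    condition open. *)
Definition few_names m (eps : R) : set (top_system G cantor_space) :=
  [set a | exists n (T : finType), [/\ (0 < n)%N, coded n m (top_act a s) T &
    ln (#|T|%:R : R) / n%:R < eps]].

Lemma open_few_names m eps : open (few_names m eps).
Proof.
rewrite openE => a [n [T [n0 [c cP] Teps]]].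
(* Closeness at the powers of [s] below [n] lets the code of [a] serve for [b] unchanged. *)
have : nbhs a [set b | forall i, (i < n)%N -> close_at m a b (s ^+ i)%g].
  elim: n {n0 cP Teps} => [|n IH]; first by apply: filterS filterT.
  apply: filterS (filterI IH (nbhs_close m a (s ^+ n)%g)) => b /= [ab abn] i.
  by rewrite ltnS leq_eqVlt => /predU1P[->//|]; exact: ab.
apply: filterS => b ab; exists n, T; split=> //; exists c => x y cxy i iN.
rewrite -!top_actX; apply: agree_trans (agree_sym (ab i iN x)) _.
apply: agree_trans (ab i iN y); rewrite !top_actX; exact: cP.
Qed.

Lemma dense_few_names m eps : 0 < eps -> dense (few_names m eps).
Proof.
move=> eps0 W [a Wa] oW.
have [|D [k DW]] := @nbhs_systemP G a W; first exact: open_nbhs_nbhs.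
have [|l lP] := @ex_uniform_bound (seq_sub D) (fun g l => forall b,
    (forall s, S s -> close_at l a b s) -> close_at k a b (val g)) _
    (fun g => ex_close_generators S_basis a (val g) k).
  move=> g i j ij + b ab; apply => t St x; exact: agree_le (ab t St x).
(* Depth [l] keeps the perturbed system inside [W]; depth [m] is the precision required of the
   code. *)
pose M := maxn l m.
have [||||h [h' [V [ch ch' hK h'K [hM hV fwd bwd]]]]] :=
    @exists_attractor (top_act a s) (top_act a s^-1) M.
- exact: top_act_ucont.
- exact: top_act_ucont.
- exact: top_actKV.
- exact: top_actVK.
have [b [bs bt]] := ex_perturbation S_basis a
  (Homeo hK h'K ((continuous_ucont h).2 ch) ((continuous_ucont h').2 ch')) Ss.
have [|n n0 nP] := @ln_lt_linear R (#|{ffun 'I_M -> bool}| ^ 2)%:R eps _ eps0.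
  by rewrite ltr0n expn_gt0 card_ffun expn_gt0 card_bool.
exists b; split.
  apply: DW => g gD; apply: (lP (SeqSub gD)) => t St x.
  have [->|/eqP ts] := eqVneq t s; last by rewrite bt.
  by rewrite bs; apply/agree_sym; apply: agree_le (hM _); rewrite leq_maxl.
exists n, ('I_n.+1 * ({ffun 'I_M -> bool} * {ffun 'I_M -> bool}))%type; split=> //.
  apply: (@coded_le _ _ M); first by rewrite leq_maxr.
  apply: (@coded_eq _ _ (h \o top_act a s)) => [x|]; first by rewrite /= bs.
  exact: coded_attractor hV fwd bwd.
by rewrite !card_prod card_ord mulnn natrM.
Qed.

End FewNames.

(** * From few orbit names to zero naive entropy *)

Section Entropy.
Variable R : realType.

Lemma min_subcoverP (X : Type) (U : set (set X)) k :
  subcover_cards U k -> (min_subcover U <= k)%N.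
Proof.
move=> Uk.
have [|_ -> //] := @getPex _ [set k | subcover_cards U k /\
    forall j, subcover_cards U j -> (k <= j)%N].
have ex : exists k, `[< subcover_cards U k >] by exists k; exact/asboolP.
have [l /asboolP Ul lmin] := ex_minnP ex.
by exists l; split=> // j /asboolP; exact: lmin.
Qed.

Lemma min_subcover_coded (X : Type) (W : set (set X)) (T : finType) (c : X -> T) :
  (forall x, exists A, W A /\ forall y, c y = c x -> A y) ->
  (min_subcover W <= #|T|)%N.
Proof.
move=> /choice[A AP].
pose A' t := get [set B | exists2 x, c x = t & B = A x].
have A'P x : exists2 y, c y = c x & A' (c x) = A y.
  by apply: (@getPex _ [set B | exists2 y, c y = c x & B = A y]); exists (A x), x.
set V := A' @` range c.
have cardV : (V #<= `I_#|T|)%card.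
  apply: card_le_trans (card_image_le _ _) _.
  apply: (@card_le_trans _ _ _ [set: T]); first exact: subset_card_le.
  have idx : ((fun t : T => nat_of_ord (enum_rank t)) @` setT #= [set: T])%card.
    by apply: inj_card_eq => t u _ _ /ord_inj/enum_rank_inj.
  by rewrite -(card_le_eql idx); apply: subset_card_le => _ [t _ <-] /=.
have [k Vk] : exists k, (V #= `I_k)%card.
  by apply/finite_setP; apply: card_le_finite cardV _; exact: finite_II.
have kT : (k <= #|T|)%N by rewrite -card_le_II -(card_le_eql Vk).
apply: leq_trans kT; apply: min_subcoverP; exists V; split=> //.
  by move=> _ [_ [x _ <-] <-]; have [y _ ->] := A'P x; have [] := AP y.
apply/seteqP; split=> // x _; exists (A' (c x)); first by exists (c x) => //; exists x.
by have [y cyx ->] := A'P x; apply: (AP y).2.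
Qed.

Variables (G : groupType) (X : uniformType) (a : top_system G X).

Lemma naive_entropy_ge0 : (0 <= naive_entropy R a)%E.
Proof.
apply: (@le_trans _ _ (naive_entropy_cover R a [set setT])); last first.
  apply: ereal_sup_ubound; exists [set setT] => //; split; first exact: finite_set1.
  split=> [A ->|]; first exact: openT.
  by rewrite /covers bigcup_set1.
apply: le_ereal_inf_tmp => _ [F /= F0 <-]; rewrite lee_fin divr_ge0 //.
(* The value 0 is possible, for instance when [X] is empty; then [ln 0 = 0] keeps the quotient
   nonnegative. *)
have [->|] := posnP (min_subcover (iterated_join a [set setT] F)).
  by rewrite ln0.
by move=> ?; rewrite ln_ge0 // ler1n.
Qed.
End Entropy.

(** At the depth of a Lebesgue number of [U], points with the same code share a member of the
    iterated join. Injectivity of powers ensures that the finite set has exactly [n] elements. *)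
Lemma entropy0_few_names (R : realType) (G : groupType) (s : G)
    (a : top_system G cantor_space) : injective (fun n => s ^+ n)%g ->
  (forall m eps, 0 < eps -> few_names s m (eps : R) a) ->
  naive_entropy R a = 0%E.
Proof.
move=> s_inj aP; apply/eqP; rewrite eq_le naive_entropy_ge0 andbT.
apply: ge_ereal_sup => _ [U [_ Ucover] <-].
have [m mP] := lebesgue_number Ucover.
apply/lee_addgt0Pr => eps eps0; rewrite add0e.
have [n [T [n0 [c cP] Teps]]] := aP m eps eps0.
(* Inverse powers, because [x] lies in [g U] iff [g^-1 x] lies in [U]. *)
pose F := [fset (s ^- i)%g | i in iota 0 n]%fset.
have cardF : #|` F| = n.
  rewrite card_imfset /= ?undup_id ?iota_uniq ?size_iota //.
  by move=> i j /invg_inj; exact: s_inj.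
apply: le_trans (ereal_inf_lbound _) _; first exists F => //=.
  by rewrite -cardfs_gt0 cardF.
rewrite lee_fin cardF; apply: le_trans (ltW Teps).
rewrite ler_pM2r ?invr_gt0 ?ltr0n //.
have : (min_subcover (iterated_join a U F) <= #|T|)%N.
  apply: (@min_subcover_coded _ _ _ c) => x.
  have /choice[B BP] : forall g, exists A, U A /\ agree m (top_act a g^-1%g x) `<=` A.
    by move=> g; have [A UA xA] := mP (top_act a g^-1%g x); exists A.
  exists (\bigcap_(g in [set` F]) (top_act a g @` B g)); split.
    exists (fun g => top_act a g @` B g) => // g gF.
    by exists (B g) => //; have [] := BP g.
  move=> y cyx g /= /imfsetP[i /=]; rewrite mem_iota => iN ->.
  exists (top_act a (s ^+ i)%g y); last by rewrite -top_actM mulVg top_act1.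
  by apply: (BP _).2; rewrite invgK !top_actX; apply: cP.
have [->|N0] := posnP (min_subcover (iterated_join a U F)).
  rewrite ln0 // => _; have [->|] := posnP #|T|; first by rewrite ln0.
  by move=> ?; rewrite ln_ge0 // ler1n.
by move=> NT; rewrite ler_ln ?posrE ?ltr0n ?ler_nat // (leq_trans N0 NT).
Qed.

Theorem theorem1p2 (R : realType) (F : groupType)
    (F_countable : countable [set: F]) (F_free : free_group F)
    (F_nontrivial : exists g : F, g <> 1%g) :
  comeager [set a : top_system F cantor_space | naive_entropy R a = 0%E].
Proof.
have [S S_basis] := F_free.
have [s Ss] := basis_nonempty S_basis F_nontrivial.
exists (\bigcap_i few_names s i (i.+1%:R^-1 : R)).
  exists (fun i => few_names s i (i.+1%:R^-1 : R)) => // i; split.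
    exact: open_few_names.
  exact: dense_few_names.
move=> a aP; apply: (entropy0_few_names (basis_expg_inj S_basis Ss)) => m eps eps0.
(* The index governs both parameters: [i >= m] gives enough depth, and [i + 1 > 1 / eps] a small
   enough bound. *)
pose i := maxn m (Num.trunc eps^-1).
have [n [T [n0 /(coded_le (leq_maxl _ _)) aT Teps]]] := aP i I.
exists n, T; split=> //; apply: lt_le_trans Teps _.
rewrite -[leRHS]invrK lef_pV2 ?posrE ?invr_gt0 ?ltr0n //.
apply: le_trans (ltW (truncnS_gt _)) _; by rewrite ler_nat ltnS leq_maxr.
Qed.
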